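(* For every poset $\mathcal{P}$ with $n$ elements (on the ground set $[n]$), $$e(\mathcal{P}) \ge \frac{n!}{\prod_{i=1}^n d(i)}, \qquad d(i) := \left|\{ j \in \mathcal{P} : j \le i \text{ in } \mathcal{P} \}\right|,$$ where $e(\mathcal{P})$ is the number of linear extensions of $\mathcal{P}$.
   Context: A linear extension of a poset $\mathcal{P}$ on $[n]=\{1,\dots,n\}$ is a permutation $\omega$ of $[n]$ such that $\omega(i) > \omega(j)$ whenever $j < i$ in $\mathcal{P}$. The element labels are arbitrary and need not be compatible with the order of $\mathcal{P}$. *)

(* Defs.v *)
From mathcomp Require Import all_boot all_order all_fingroup all_algebra.

Set Implicit Arguments.
Unset Strict Implicit.
Unset Printing Implicit Defensive.

(* The ground set [n] = {1, ..., n} is represented by 'I_n = {0, ..., n-1}.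
   A poset on it is a relation [le : rel 'I_n], [le j i] meaning "j <= i in P";
   it is unrelated to the order of the labels as natural numbers. *)
Definition is_poset (n : nat) (le : rel 'I_n) : Prop :=
  [/\ reflexive le, antisymmetric le & transitive le].

(* In [w j < w i], the values of w are compared as natural numbers. *)
Definition linear_extension (n : nat) (le : rel 'I_n) (w : {perm 'I_n}) : bool :=
  [forall i, forall j, (j != i) && le j i ==> (w j < w i)%N].

Definition num_linear_extensions (n : nat) (le : rel 'I_n) : nat :=
  #|[set w : {perm 'I_n} | linear_extension le w]|.

Definition down_size (n : nat) (le : rel 'I_n) (i : 'I_n) : nat :=
  #|[set j : 'I_n | le j i]|.

(* Main.v *)
Require Import Defs.
From mathcomp Require Import all_boot all_order all_fingroup all_algebra.

Set Implicit Arguments.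
Unset Strict Implicit.
Unset Printing Implicit Defensive.

(** The proof is by induction on n, on the integral form
    n! <= e(P) * \prod_i d(i).

    The largest value of a linear extension is taken at a maximal element x, and
    what remains is a linear extension of P - x; conversely any linear extension
    of P - x can be completed by giving x the largest value.  Hence e(P) is at
    least the sum of e(P - x) over the maximal elements x
    ([sum_extensions_del_le]).  Deleting a maximal x changes no other down-set
    size ([down_size_del]), so the induction hypothesis gives
    e(P - x) * \prod_i d(i) >= (n - 1)! * d(x).  Summing over x, it remains to see
    that the d(x), for x maximal, add up to at least n: the down-sets of the
    maximal elements cover the ground set ([sum_down_size_maximal_ge]). *)

Lemma down_size_gt0 n (le : rel 'I_n) i : reflexive le -> 0 < down_size le i.
Proof. by move=> le_refl; apply/card_gt0P; exists i; rewrite inE. Qed.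

Definition maximal n (le : rel 'I_n) (x : 'I_n) : bool :=
  [forall y, le x y ==> (y == x)].

(** [lift x] enumerates the labels other than [x], so that the poset without [x]
    again lives on an initial segment of the naturals. *)
Definition del n (le : rel 'I_n.+1) (x : 'I_n.+1) : rel 'I_n :=
  relpre (lift x) le.

Lemma del_poset n (le : rel 'I_n.+1) x : is_poset le -> is_poset (del le x).
Proof.
case=> le_refl le_anti le_trans; split=> [i | i j le_ij | i j k].
- exact: le_refl.
- exact: lift_inj (le_anti _ _ le_ij).
- exact: le_trans.
Qed.

(** An element above [i] whose down-set is as large as possible is maximal: a
    strictly larger element would have a strictly larger down-set. *)
Lemma maximal_above n (le : rel 'I_n) i :
  is_poset le -> exists2 x, maximal le x & le i x.
Proof.
case=> le_refl le_anti le_trans.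
case: (arg_maxnP (down_size le) (le_refl i)) => x le_ix x_max.
exists x => //; apply/forallP=> y; apply/implyP=> le_xy.
have sub_xy : [set j | le j x] \subset [set j | le j y].
  by apply/subsetP=> j; rewrite !inE => /le_trans; apply.
have /eqP/setP/(_ y) : [set j | le j x] == [set j | le j y].
  by rewrite eqEcard sub_xy; apply: x_max; apply: le_trans le_xy.
by rewrite !inE le_refl => le_yx; apply/eqP/le_anti; rewrite le_yx.
Qed.

Lemma sum_down_size_maximal_ge n (le : rel 'I_n) :
  is_poset le -> n <= \sum_(x | maximal le x) down_size le x.
Proof.
move=> le_poset; rewrite -[leqLHS]card_ord -sum1_card.
have -> : \sum_(x | maximal le x) down_size le x
        = \sum_(i < n) \sum_(x | maximal le x && le i x) 1.
  under eq_bigr do rewrite /down_size -sum1dep_card big_mkcond.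
  by rewrite exchange_big; under eq_bigr do rewrite -big_mkcondr.
apply: leq_sum => i _; have [x x_max le_ix] := maximal_above i le_poset.
by rewrite (bigD1 x) ?x_max.
Qed.

Lemma down_size_del n (le : rel 'I_n.+1) x k :
  maximal le x -> down_size (del le x) k = down_size le (lift x k).
Proof.
move=> /forallP x_max; rewrite /down_size -(card_imset _ (@lift_inj _ x)).
apply: eq_card => j; rewrite inE; apply/imsetP/idP => [[i]|le_jk].
  by rewrite inE => le_ik ->.
case: (unliftP x j) => [i|] def_j; first by exists i; rewrite // inE /del /= -def_j.
(* Here [j = x] would lie below [lift x k], which differs from [x]. *)
by have := x_max (lift x k); rewrite -{1}def_j le_jk eq_sym (negPf (neq_lift _ _)).
Qed.

Lemma lift_perm_inj n (i j : 'I_n.+1) : injective (lift_perm i j).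
Proof.
move=> s t eq_st; apply/permP=> k; apply: (@lift_inj _ j).
by rewrite -!(lift_perm_lift i j) eq_st.
Qed.

(** Giving [x] the largest value is harmless because nothing lies above [x], and
    the other comparisons are those of [s] since [lift ord_max] preserves values. *)
Lemma linear_extension_lift n (le : rel 'I_n.+1) x (s : {perm 'I_n}) :
    maximal le x -> linear_extension (del le x) s ->
  linear_extension le (lift_perm x ord_max s).
Proof.
move=> /forallP x_max /forallP s_ext; apply/forallP=> i; apply/forallP=> j.
apply/implyP=> /andP[neq_ji le_ji].
case: (unliftP x j) => [j'|] def_j; last first.
  by have := x_max i; rewrite -def_j le_ji eq_sym (negPf neq_ji).
rewrite def_j lift_perm_lift lift_max.
case: (unliftP x i) => [i'|] def_i; last by rewrite def_i lift_perm_id ltn_ord.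
rewrite def_i lift_perm_lift lift_max.
have /forallP/(_ j')/implyP := s_ext i'; apply.
by rewrite /del /= -def_i -def_j le_ji andbT -(inj_eq (@lift_inj _ x)) -def_i -def_j.
Qed.

Lemma extensions_del_le n (le : rel 'I_n.+1) x :
    maximal le x ->
  num_linear_extensions (del le x)
    <= #|[set w : {perm 'I_n.+1} | linear_extension le w & w x == ord_max]|.
Proof.
move=> x_max.
rewrite /num_linear_extensions -(card_imset _ (@lift_perm_inj _ x ord_max)).
apply/subset_leq_card/subsetP=> _ /imsetP[s + ->]; rewrite !inE => s_ext.
by rewrite linear_extension_lift //= lift_perm_id.
Qed.

Lemma sum_extensions_del_le n (le : rel 'I_n.+1) :
  \sum_(x | maximal le x) num_linear_extensions (del le x)
    <= num_linear_extensions le.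
Proof.
rewrite {2}/num_linear_extensions -sum1dep_card.
(* Sort the linear extensions by the element that gets the largest value. *)
rewrite (partition_big (fun w : {perm _} => (w^-1)%g ord_max) predT) //= big_mkcond.
apply: leq_sum => x _; case: ifP => // /extensions_del_le /leq_trans; apply.
rewrite sum1dep_card; apply/subset_leq_card/subsetP=> w; rewrite !inE.
by case/andP=> -> /eqP <-; rewrite permK eqxx.
Qed.

Lemma fact_le_extensions_mul_prod_down_size n (le : rel 'I_n) :
    is_poset le ->
  n`! <= num_linear_extensions le * \prod_(i < n) down_size le i.
Proof.
elim: n le => [|n IHn] le le_poset.
  rewrite big_ord0 muln1; apply/card_gt0P; exists 1%g.
  by rewrite inE; apply/forallP; case.
apply: leq_trans (leq_mul (sum_extensions_del_le le) (leqnn _)).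
rewrite factS big_distrl /=.
apply: leq_trans (leq_mul (sum_down_size_maximal_ge le_poset) (leqnn _)) _.
rewrite big_distrl; apply: leq_sum => x x_max /=.
rewrite (bigD1_ord x) //= mulnCA leq_mul2l; apply/orP; right.
under eq_bigr do rewrite -down_size_del //.
exact/IHn/del_poset.
Qed.

Unset Implicit Arguments.
Local Open Scope ring_scope.

Theorem corollary2 (n : nat) (le : rel 'I_n) (le_poset : is_poset le) :
  (n`!)%:R / (\prod_(i < n) (down_size le i)%:R)
    <= (num_linear_extensions le)%:R :> rat.
Proof.
have [le_refl _ _] := le_poset.
rewrite -GRing.natr_prod Num.Theory.ler_pdivrMr; last first.
  by rewrite Num.Theory.ltr0n; apply: prodn_gt0 => i; apply: down_size_gt0.
rewrite -GRing.natrM Num.Theory.ler_nat.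
exact: fact_le_extensions_mul_prod_down_size.
Qed.
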